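(* Let $C_1,\ldots,C_N\subset\mathbb{R}^d$ be closed convex sets with nonempty intersection $C=C_1\cap\cdots\cap C_N$. Let $\beta=(\beta_1,\ldots,\beta_N)\in\mathcal{B}$ and let $I\subset\{1,2,\ldots,N\}$ be nonempty. Then for any $x\in\mathbb{R}^d$ and any $c\in C$, $$\|Q_\beta(x)-c\|^2\le\|x-c\|^2-\min_{i\in I}\nu_i\;\max_{i\in I}d^2(x,C_i),$$ where $$\nu_i=\frac{2\beta_i\left(2-\sum_{k=1}^N\beta_k\right)}{\beta_i+2-\sum_{k=1}^N\beta_k}.$$ In particular the inequality holds when $I=\{i: 1\le i\le N,\ \beta_i>0\}$ is the set of active indices of $\beta$ (if this set is nonempty).
   Context: $\|\cdot\|$ is the Euclidean norm on $\mathbb{R}^d$; for a nonempty closed convex set $D\subset\mathbb{R}^d$, $P_D$ is the (nearest point) projection onto $D$, $d(x,D)$ is the distance from $x$ to $D$, and $d^2(x,D)=(d(x,D))^2$. The parameter set is $\mathcal{B}=\{\beta=(\beta_1,\ldots,\beta_N): \beta_i\ge 0 \text{ for all } i,\ \sum_{i=1}^N\beta_i\le 2\}$. For $\beta\in\mathcal{B}$ the operator $Q_\beta:\mathbb{R}^d\to\mathbb{R}^d$ is $Q_\beta=\mathrm{Id}-\sum_{j=1}^N\beta_j(\mathrm{Id}-P_{C_j})$, where $\mathrm{Id}$ is the identity. Convention: $\nu_i=0$ if the denominator in its definition vanishes (i.e. $\beta_i=0$ and $\sum_k\beta_k=2$). *)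

(* Defs.v *)
From HB Require Import structures.
From mathcomp Require Import all_boot all_order all_algebra.
From mathcomp Require Import all_classical all_reals all_analysis.
Set Implicit Arguments.
Unset Strict Implicit.
Unset Printing Implicit Defensive.
Import Order.TTheory GRing.Theory Num.Theory.
Import numFieldNormedType.Exports.
Local Open Scope classical_set_scope.
Local Open Scope ring_scope.

Section Defs.
Context {R : realType}.

(* The library norm `|x| on 'rV[R]_d is the sup norm, so the Euclidean norm has
   to be introduced separately.  Both norms induce the same topology, hence the
   library's [closed] is the intended notion of closed set. *)
Definition eucl_norm (d : nat) (x : 'rV[R]_d) : R :=
  Num.sqrt (\sum_(k < d) x 0 k ^+ 2).

(* Only meaningful for D nonempty: [inf] of the empty set is 0. *)
Definition eucl_dist (d : nat) (x : 'rV[R]_d) (D : set 'rV[R]_d) : R :=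
  inf [set eucl_norm (x - y) | y in D].

(* The point of D nearest to x.  It exists and is unique when D is nonempty,
   closed and convex; if there is no nearest point the value is x. *)
Definition metric_proj (d : nat) (D : set 'rV[R]_d) (x : 'rV[R]_d) : 'rV[R]_d :=
  xget x [set y | D y /\ forall z, D z -> eucl_norm (x - y) <= eucl_norm (x - z)].

Definition paramB (N : nat) : set ('I_N -> R) :=
  [set beta | (forall i, 0 <= beta i) /\ \sum_(i < N) beta i <= 2].

Definition Qop (d N : nat) (C : 'I_N -> set 'rV[R]_d) (beta : 'I_N -> R)
    (x : 'rV[R]_d) : 'rV[R]_d :=
  x - \sum_(j < N) beta j *: (x - metric_proj (C j) x).

(* If the denominator vanishes then the value is 0, since 0^-1 = 0. *)
Definition nu_coef (N : nat) (beta : 'I_N -> R) (i : 'I_N) : R :=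
  (2 * beta i * (2 - \sum_(k < N) beta k)) /
  (beta i + 2 - \sum_(k < N) beta k).

Definition active (N : nat) (beta : 'I_N -> R) : {set 'I_N} :=
  [set i | 0 < beta i]%SET.

(* Minimum and maximum of f over a nonempty finite set I.  The iterated min (max)
   starts from the value at some element of I, so it ranges over I only; the
   value for I empty is junk. *)
Definition minover (T : finType) (I : {set T}) (f : T -> R) : R :=
  if [pick i in I] is Some i0 then \big[Num.min/f i0]_(i in I) f i else 0.

Definition maxover (T : finType) (I : {set T}) (f : T -> R) : R :=
  if [pick i in I] is Some i0 then \big[Num.max/f i0]_(i in I) f i else 0.

End Defs.

(* Main.v *)
(** Put u_j = x - P_{C_j} x, s = sum_j beta_j and w = sum_j beta_j u_j, so that
    Q_beta x - c = (x - c) - w.  The obtuse angle property of projections gives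
    <u_j, x - c> >= |u_j|^2, hence
    |Q_beta x - c|^2 <= |x - c|^2 - 2 sum_j beta_j |u_j|^2 + |w|^2.
    Fix an index i and set e = beta_i + 2 - s.  Then w is also the sum of the
    beta_j u_j, j <> i, and of e (beta_i / e) u_i, whose weights add up to 2;
    Jensen's inequality for the squared norm bounds |w|^2 by
    2 sum_j beta_j |u_j|^2 - nu_i |u_i|^2.  Take i to maximize d(x, C_i) on I. *)
Require Import Defs.
From HB Require Import structures.
From mathcomp Require Import all_boot all_order all_algebra.
From mathcomp Require Import all_classical all_reals all_analysis.
From mathcomp Require Import ring lra.
Import Order.TTheory GRing.Theory Num.Theory.
Import numFieldNormedType.Exports.
Local Open Scope classical_set_scope.
Local Open Scope ring_scope.

(** * Euclidean inner product and Jensen's inequality *)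

Definition dot {R : realType} {d : nat} (u v : 'rV[R]_d) : R :=
  \sum_(k < d) u 0 k * v 0 k.

Section Dot.
Context {R : realType} {d : nat}.
Implicit Types (u v w : 'rV[R]_d) (a : R).

Lemma dotC u v : dot u v = dot v u.
Proof. by apply: eq_bigr => k _; rewrite mulrC. Qed.

Lemma dotDl u v w : dot (u + v) w = dot u w + dot v w.
Proof. by rewrite -big_split; apply: eq_bigr => k _; rewrite mxE mulrDl. Qed.

Lemma dotZl a u v : dot (a *: u) v = a * dot u v.
Proof. by rewrite mulr_sumr; apply: eq_bigr => k _; rewrite mxE mulrA. Qed.

Lemma dotNl u v : dot (- u) v = - dot u v.
Proof. by rewrite -scaleN1r dotZl mulN1r. Qed.

Lemma dot_suml (J : finType) (F : J -> 'rV[R]_d) v :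
  dot (\sum_j F j) v = \sum_j dot (F j) v.
Proof.
rewrite exchange_big; apply: eq_bigr => k _.
by rewrite summxE mulr_suml.
Qed.

Lemma dot_sqrB u v : dot (u - v) (u - v) = dot u u - 2 * dot u v + dot v v.
Proof.
rewrite dotDl !(dotC _ (u - v)) !dotDl !dotNl !(dotC _ (- v)) !dotNl (dotC v u).
ring.
Qed.

Lemma dot_ge0 u : 0 <= dot u u.
Proof. by apply: sumr_ge0 => k _; exact: sqr_ge0. Qed.

Lemma eucl_norm_sqr u : eucl_norm u ^+ 2 = dot u u.
Proof. by rewrite sqr_sqrtr// sumr_ge0// => k _; rewrite sqr_ge0. Qed.

Lemma ler_eucl_norm u v : (eucl_norm u <= eucl_norm v) = (dot u u <= dot v v).
Proof. by rewrite -!eucl_norm_sqr ler_sqr ?nnegrE ?sqrtr_ge0. Qed.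

Lemma dot_coord_le u k : u 0 k ^+ 2 <= dot u u.
Proof.
by rewrite /dot (bigD1 k)//= expr2 lerDl sumr_ge0// => j _; exact: sqr_ge0.
Qed.

(* The defect is the variance [\sum_j g j * |v j - m|^2] about the mean [m]. *)
Lemma dot_jensen {J : finType} {g : J -> R} (v : J -> 'rV[R]_d) :
  (forall j, 0 <= g j) -> \sum_j g j = 1 ->
  dot (\sum_j g j *: v j) (\sum_j g j *: v j) <= \sum_j g j * dot (v j) (v j).
Proof.
move=> g0 g1; set m := \sum_j g j *: v j.
have mE : dot m m = \sum_j g j * dot (v j) m.
  by rewrite {1}/m dot_suml; apply: eq_bigr => j _; rewrite dotZl.
have : 0 <= \sum_j g j * dot (v j - m) (v j - m).
  by apply: sumr_ge0 => j _; rewrite mulr_ge0 ?dot_ge0.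
have -> : \sum_j g j * dot (v j - m) (v j - m) =
    \sum_j g j * dot (v j) (v j) - 2 * (\sum_j g j * dot (v j) m)
    + (\sum_j g j) * dot m m.
  rewrite mulr_sumr mulr_suml -sumrB -big_split/=; apply: eq_bigr => j _.
  rewrite dot_sqrB; ring.
rewrite -mE g1; lra.
Qed.

End Dot.

(** * Nearest points of closed convex sets *)

Section Projection.
Context {R : realType} {d : nat} {D : set 'rV[R]_d}.
Implicit Types (x y z p : 'rV[R]_d).

Definition nearest x p :=
  D p /\ forall z, D z -> eucl_norm (x - p) <= eucl_norm (x - z).

Lemma continuous_dotB x : continuous (fun y : 'rV[R]_d => dot (x - y) (x - y)).
Proof.
apply: continuous_big => [|k _ y]; first exact: add_continuous.
have cxy : {for y, continuous (fun y => (x - y) 0 k)}.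
  rewrite (_ : (fun _ => _) = fun y => x 0 k - y 0 k); last first.
    by apply/funext => z; rewrite !mxE.
  by apply: continuousB; [exact: cst_continuous | exact: coord_continuous].
exact: (continuousM cxy).
Qed.

(** Extreme value theorem on the part [K] of [D] no farther from [x] than some point [c] of [D]; the
    points of [D] outside [K] are farther from [x] than every point of [K]. *)
Lemma nearest_exists x : closed D -> D !=set0 -> exists p, nearest x p.
Proof.
move=> Dcl [c Dc].
pose r := eucl_norm (x - c); have r0 : 0 <= r by exact: sqrtr_ge0.
pose K := D `&` [set y | dot (x - y) (x - y) <= r ^+ 2].
have Kc : K c by split=> //=; rewrite eucl_norm_sqr.
have Kcl : closed K.
  apply: closedI => //.
  apply: (preimage_closed (D := [set t | t <= r ^+ 2])); last exact: closed_le.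
  by move=> y _; exact: continuous_dotB.
(* [K] lies in the cube of half-width [r] about [x], a product of segments. *)
have Kcpt : compact K.
  apply: (subclosed_compact Kcl (rV_compact
    (A := fun k => `[x 0 k - r, x 0 k + r]%classic)
    (fun k => @segment_compact _ _ _))).
  move=> y [_ /= yr] k; rewrite in_itv/=.
  have := le_trans (dot_coord_le (x - y) k) yr.
  rewrite -[_ ^+ 2 <= _]ler_sqrt ?sqr_ge0// !sqrtr_sqr (ger0_norm r0).
  rewrite !mxE ler_norml lerBlDr => /andP[? ?].
  by rewrite lerBlDr; apply/andP; split; lra.
have [p /set_mem[Dp pr] pmin] := compact_EVT_min (ex_intro _ c Kc) Kcpt
  (continuous_subspaceT (continuous_dotB x)).
exists p; split=> // z Dz; rewrite ler_eucl_norm.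
have [zr|/ltW zr] := leP (dot (x - z) (x - z)) (r ^+ 2).
  by apply: pmin; apply/mem_set.
exact: le_trans zr.
Qed.

(** Moving from [p] towards [z] by a fraction [t] changes the squared distance to [x] by
    [t ^+ 2 * A - 2 * t * B], which would be negative for small [t] if [B] were positive. *)
Lemma nearest_obtuse {x p z} : convex_set D -> nearest x p -> D z ->
  dot (x - p) (z - p) <= 0.
Proof.
move=> Dcvx [Dp pmin] Dz; rewrite leNgt; apply/negP => B0.
set B := dot _ _ in B0; pose A := dot (z - p) (z - p).
have step t : 0 <= t -> t <= 1 -> 2 * t * B <= t ^+ 2 * A.
  move=> t0 t1.
  have /set_mem/pmin := Dcvx z p (Itv01 t0 t1) (mem_set Dz) (mem_set Dp).
  have -> : x - conv (Itv01 t0 t1) (z : convex_lmodType _) p =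
      (x - p) - t *: (z - p).
    rewrite /conv/= /unstable.onem scalerBr scalerBl scale1r.
    by apply/rowP => k; rewrite !mxE; ring.
  rewrite ler_eucl_norm (dot_sqrB (x - p)) (dotC _ (_ *: _)) dotZl.
  rewrite (dotC (z - p)) dotZl (dotC _ (_ *: _)) dotZl -/A -/B; lra.
have A0 : 0 < A by have := step 1 ler01 (lexx _); lra.
(* The quadratic in [t] is least at [B / A], which is admissible only if at most 1; otherwise
   [t = 1] already gives a contradiction. *)
have [AB|BA] := leP A B.
  by have := step 1 ler01 (lexx _); lra.
have := step (B / A) (divr_ge0 (ltW B0) (ltW A0)).
rewrite ler_pdivrMr// mul1r => /(_ (ltW BA)).
have -> : 2 * (B / A) * B = 2 * (B ^+ 2 / A) by ring.
have -> : (B / A) ^+ 2 * A = B ^+ 2 / A by field; rewrite gt_eqF.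
have : 0 < B ^+ 2 / A by rewrite divr_gt0// exprn_gt0.
lra.
Qed.

Lemma metric_proj_nearest x : closed D -> D !=set0 -> nearest x (metric_proj D x).
Proof. by move=> Dcl D0; apply: (xgetPex x); exact: nearest_exists. Qed.

Lemma metric_proj_firm x c : closed D -> convex_set D -> D c ->
  let u := x - metric_proj D x in dot u u <= dot u (x - c).
Proof.
move=> Dcl Dcvx Dc /=.
have np := metric_proj_nearest x Dcl (ex_intro _ c Dc).
have := nearest_obtuse Dcvx np Dc; set p := metric_proj D x => h.
have -> : x - c = (x - p) - (c - p) by rewrite opprB addrA subrK.
rewrite [leRHS]dotC [leRHS]dotDl dotNl (dotC (c - p)); lra.
Qed.

(** The projection is one of the points over which the infimum is taken. *)
Lemma eucl_dist_le_metric_proj x : closed D -> D !=set0 ->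
  let u := x - metric_proj D x in 0 <= eucl_dist x D ^+ 2 <= dot u u.
Proof.
move=> Dcl D0 /=; have [Dp _] := metric_proj_nearest x Dcl D0.
have lb : lbound [set eucl_norm (x - y) | y in D] 0.
  by move=> _ [y _ <-]; exact: sqrtr_ge0.
rewrite sqr_ge0 -eucl_norm_sqr ler_sqr ?nnegrE ?sqrtr_ge0//.
  by apply: ge_inf; [exists 0|exists (metric_proj D x)].
apply: lb_le_inf => //; case: D0 => y Dy; by exists (eucl_norm (x - y)), y.
Qed.

End Projection.

(** * Extrema over an index set, and the estimate at one index *)

Lemma minover_le {R : realType} {T : finType} {I : {set T}} (f : T -> R) i :
  i \in I -> minover I f <= f i.
Proof.
rewrite /minover; case: pickP => [i0 _ iI|/(_ i) /= ->//].
exact: bigmin_le_cond.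
Qed.

Lemma maxover_attained {R : realType} {T : finType} {I : {set T}} (f : T -> R) :
  I != finset.set0 -> exists2 i, i \in I & maxover I f = f i.
Proof.
case/set0Pn => i iI; rewrite /maxover.
case: pickP => [i0 i0I|/(_ i)]; last by rewrite iI.
apply: (big_ind (fun t => exists2 i, i \in I & t = f i)).
- by exists i0.
- by move=> s t hs ht; rewrite maxEle; case: ifP.
- by move=> j jI; exists j.
Qed.

Lemma Qop_le {R : realType} {d N : nat} {C : 'I_N -> set 'rV[R]_d}
  (C_closed : forall i, closed (C i))
  (C_convex : forall i, convex_set (C i))
  {beta : 'I_N -> R} (betaB : paramB beta) (i : 'I_N) (x : 'rV[R]_d)
  {c : 'rV[R]_d} :
  (forall j, C j c) ->
  let u := x - metric_proj (C i) x in
  dot (Qop C beta x - c) (Qop C beta x - c) <=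
    dot (x - c) (x - c) - nu_coef beta i * dot u u.
Proof.
case: betaB => beta0; set s := \sum_(k < N) beta k => s2 Cc /=.
pose u j := x - metric_proj (C j) x; rewrite -/(u i).
pose w := \sum_j beta j *: u j.
have -> : Qop C beta x - c = (x - c) - w.
  by rewrite /Qop -/w addrAC.
rewrite [leLHS]dot_sqrB.
have cross : \sum_j beta j * dot (u j) (u j) <= dot (x - c) w.
  rewrite dotC dot_suml; apply: ler_sum => j _; rewrite dotZl ler_wpM2l//.
  exact: metric_proj_firm.
have sE : s = beta i + \sum_(j | j != i) beta j by rewrite /s (bigD1 i).
pose e := beta i + 2 - s.
have e0 : 0 <= e by have := beta0 i; rewrite /e; lra.
pose theta := beta i / e.
have eth : e * theta = beta i.
  (* [e] is the sum of the nonnegative numbers [beta i] and [2 - s], so [e = 0] forces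
     [beta i = 0]. *)
  rewrite /theta; have [ez|enz] := eqVneq e 0.
    by have := beta0 i; rewrite ez invr0; move: ez; rewrite /e; lra.
  by rewrite mulrC divfK.
(* The slack [2 - s] is added to the weight of index [i], whose vector is
   rescaled by [theta] so that the weighted sum does not change. *)
pose g j := (if j == i then e else beta j) / 2.
pose v j := if j == i then theta *: u j else u j.
have g0 j : 0 <= g j by rewrite /g; case: ifP => _; rewrite divr_ge0.
have neqF (F G : 'I_N -> R) :
    \sum_(j | j != i) (if j == i then F j else G j) = \sum_(j | j != i) G j.
  by apply: eq_bigr => j /negPf ->.
have g1 : \sum_j g j = 1.
  by rewrite -mulr_suml (bigD1 i)//= eqxx neqF /e sE; field.
(* Jensen needs total weight 1 instead of 2, hence the half. *)
have wE : 2^-1 *: w = \sum_j g j *: v j.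
  rewrite scaler_sumr; apply: eq_bigr => j _; rewrite scalerA /g /v.
  have [->|_] := eqVneq j i; last by congr (_ *: _); field.
  by rewrite scalerA -eth; congr (_ *: _); field.
have := dot_jensen v g0 g1; rewrite -[X in dot X X]wE.
(* The gain is at index [i]: its term carries [e * theta ^+ 2 = beta i * theta] in place of
   [beta i]. *)
have -> : \sum_j g j * dot (v j) (v j) =
    (\sum_j beta j * dot (u j) (u j)
      - beta i * (1 - theta) * dot (u i) (u i)) / 2.
  rewrite (bigD1 i)//= [in RHS](bigD1 i)//= /g /v eqxx.
  rewrite (eq_bigr (fun j => beta j * dot (u j) (u j) / 2)); last first.
    by move=> j /negPf ->; ring.
  by rewrite -mulr_suml dotZl (dotC _ (_ *: _)) dotZl -[in RHS]eth; field.
(* Here [1 - theta = (2 - s) / e]; if [e = 0], both sides vanish because [beta i = 0]. *)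
have -> : nu_coef beta i = 2 * (beta i * (1 - theta)).
  rewrite /nu_coef -/s -/e /theta; have [ez|enz] := eqVneq e 0.
    by rewrite ez invr0; move: eth; rewrite ez; lra.
  by rewrite /e in enz *; field.
rewrite dotZl (dotC w) dotZl; lra.
Qed.

Theorem theorem1 (R : realType) (d N : nat) (C : 'I_N -> set 'rV[R]_d)
  (C_closed : forall i, closed (C i))
  (C_convex : forall i, convex_set (C i))
  (C_meet : (\bigcap_(i in [set: 'I_N]) C i) !=set0)
  (beta : 'I_N -> R) (betaB : paramB beta) :
  (forall I : {set 'I_N}, I != finset.set0 ->
    forall x c : 'rV[R]_d, (\bigcap_(i in [set: 'I_N]) C i) c ->
      eucl_norm (Qop C beta x - c) ^+ 2 <=
      eucl_norm (x - c) ^+ 2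
        - minover I (fun i => nu_coef beta i)
          * maxover I (fun i => eucl_dist x (C i) ^+ 2))
  /\
  (active beta != finset.set0 ->
    forall x c : 'rV[R]_d, (\bigcap_(i in [set: 'I_N]) C i) c ->
      eucl_norm (Qop C beta x - c) ^+ 2 <=
      eucl_norm (x - c) ^+ 2
        - minover (active beta) (fun i => nu_coef beta i)
          * maxover (active beta) (fun i => eucl_dist x (C i) ^+ 2)).
Proof.
set P := forall I, _; suff H : P by split=> //; exact: H.
move=> I I0 x c Cc; have {}Cc j : C j c by exact: Cc.
have [i iI ->] := maxover_attained (fun i => eucl_dist x (C i) ^+ 2) I0.
have /andP[d0 dle] := eucl_dist_le_metric_proj x (C_closed i) (ex_intro _ c (Cc i)).
have nu0 : 0 <= nu_coef beta i.
  case: betaB => b0 b2; have := b0 i; rewrite /nu_coef => bi.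
  by rewrite divr_ge0 ?mulr_ge0//; lra.
rewrite !eucl_norm_sqr; apply: le_trans (Qop_le C_closed C_convex betaB i x Cc) _.
(* Two comparisons at the maximizing [i]: the squared distance is replaced by the larger [dot u u],
   using [nu0], and the minimum by [nu_coef beta i], using [d0]. *)
rewrite lerB//; apply: le_trans (ler_wpM2l nu0 dle).
exact: ler_wpM2r (minover_le _ _ iI).
Qed.
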